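(* Consider the planning-cycle algorithm (Algorithm 1) described in the context, applied with initial state $z_0$, target state $z_f$, positive definite weight $Q_0$ and tolerance $\gamma>0$. Suppose that: (i) the initial position $z_0[1:2]$ and the target position $z_f[1:2]$ lie outside all obstacle balls $\mathcal B_i$, $1\le i\le n_{obs}$; (ii) there exists a contraction factor $0\le\kappa<1$ such that $$\frac{\tilde J^{(K)}}{\tilde J^{(K-1)}}\le\kappa$$ holds for all but finitely many iterations $K$, where $$\tilde J^{(K)}:=\|z^{(K)}_{N^{(K)}+1}-z_f\|_{Q_0}^2+\rho^{(K)}\,\|z_0^{(K)}-z_f\|\,\|\lambda_f^{(K)}-\mathbf 1\|^2 .$$ Then Algorithm 1 terminates after finitely many planning cycles: there exists $K<\infty$ such that the terminal state of the $K$-th cycle satisfies $\|z^{(K)}_{N^{(K)}+1}-z_f\|_{Q_0}\le\gamma$.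
   Context: Notation: $\|a\|$ is the Euclidean norm, $\|a\|_Q=\sqrt{a^\top Qa}$ for $Q$ positive definite, $a[i:j]$ is the subvector of entries $i,\dots,j$, $\mathbf 1$ is the all-ones vector. Setting. States $z\in\mathbb R^{n_z}$ (the first two entries $z[1:2]$ are the planar position), inputs $u\in\mathbb R^{n_u}$, discrete dynamics $z_{i+1}=f(z_i,u_i):=z_i+hf_c(z_i,u_i)$ with $f_c$ differentiable and step $h>0$. Bounds: $G_1(z)=z^\top Q_1z-1\le0$, $G_2(u)=u^\top Q_2u-1\le0$, with $Q_1,Q_2$ positive definite. There are bounded obstacles $\mathcal O_j$, $1\le j\le n_{obs}$, enclosed by closed balls $\mathcal B_j$ with center $p_j$ and radius $\mathrm{diam}(\mathcal O_j)/\sqrt3$; $r_j>0$ is the safe separation radius around $p_j$, and the avoidance constraints are $\|z_i[1:2]-p_j\|\ge r_j$. For a state-input sequence $\mathbf y_N=\{z_1,\dots,z_{N+1};u_1,\dots,u_N\}$ set $J(\mathbf y_N)=\|z_{N+1}-z_f\|_{Q_0}^2$. For a reference pair $y_0=(z_0',u_0')$, let $A=\partial f/\partial z(y_0)$, $B=\partial f/\partial u(y_0)$ and let $w$ be the corresponding offset, giving the affine dynamics $z_{i+1}=Az_i+Bu_i+w$. - $\mathcal P_1'(y_0;N)$: minimize $J(\mathbf y_N)$ subject to the affine dynamics, $z_1=z_0'$, $G_1(z_i)\le0$, $G_2(u_i)\le0$ and the avoidance constraints. - $\mathcal P_r(y_0;N)$: the same problem without the avoidance constraints. - $\mathcal P_s$: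 given $\tilde{\mathbf y}=\{\tilde z_i;\tilde u_i\}$ feasible for $\mathcal P_1'(y_0;N)$ and an optimizer $\bar{\mathbf y}=\{\bar z_i;\bar u_i\}$ of $\mathcal P_r(y_0;N)$, let $\lambda_{ij}$ be the largest $\lambda\in[0,1]$ with $\|(\lambda\tilde z_i+(1-\lambda)\bar z_i)[1:2]-p_j\|=r_j$ ($\lambda_{ij}:=0$ if there is none) and $\lambda_{\min,i}=\max\{0,\max_j\lambda_{ij}\}$. With variables $\lambda_f=(\lambda_{f,i})_{i=1}^{N+1}$, $\lambda_d=(\lambda_{d,i})_{i=1}^{N+1}$ put $$z_i=(1-\lambda_{\min,i}-\lambda_{f,i}+\lambda_{\min,i}\lambda_{f,i})\bar z_i+(\lambda_{\min,i}+\lambda_{f,i}-\lambda_{\min,i}\lambda_{f,i}-\lambda_{d,i})\tilde z_i+\lambda_{d,i}\tilde z_{\max\{1,i-1\}}.$$ $\mathcal P_s$ minimizes $J(\mathbf y_N)+\rho\|z_0'-z_f\|\,\|\lambda_f-\mathbf 1\|^2$ ($\rho\ge0$) subject to $0\le\lambda_{f,i}\le1$, $\lambda_{d,i}\ge0$, $\lambda_{d,i}\le k_i\lambda_{f,i}$ (with pre-selected $k_i\in[0,1]$ keeping the region free of obstacles), the affine dynamics, $z_1=z_0'$, $G_1(z_i)\le0$ and $G_2(u_i)\le0$. Algorithm 1. Start with $K=1$, $z_0^{(1)}=z_0$, $u_0^{(1)}=0$. In cycle $K$: (1) linearize $f$ at $y_0^{(K)}=(z_0^{(K)},u_0^{(K)})$;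 (2) a search algorithm returns a horizon $N^{(K)}$ and a sequence $\tilde{\mathbf y}^{(K)}$ feasible for $\mathcal P_1'(y_0^{(K)};N^{(K)})$; (3) solve $\mathcal P_r(y_0^{(K)};N^{(K)})$ to get $\bar{\mathbf y}^{(K)}$; (4) solve the corresponding $\mathcal P_s$ with weight $\rho=\rho^{(K)}\ge0$ to get an optimizer $(\lambda_f^{(K)},\lambda_d^{(K)})$ and the corresponding inputs $u_i^{(K)}$; (5) re-simulate the states with the true dynamics: $z_1^{(K)}=z_0^{(K)}$, $z_{i}^{(K)}=f(z_{i-1}^{(K)},u_{i-1}^{(K)})$ for $2\le i\le N^{(K)}+1$, and set $J^{(K)}=\|z^{(K)}_{N^{(K)}+1}-z_f\|_{Q_0}^2$; (6) if $J^{(K)}>\gamma^2$, choose an applied horizon $\hat N^{(K)}<N^{(K)}-1$, $\hat N^{(K)}\le N_{\max}$; otherwise set $\hat N^{(K)}=N^{(K)}$; (7) append $u_1^{(K)},\dots,u^{(K)}_{\hat N^{(K)}}$ to the output control, set $(z_0^{(K+1)},u_0^{(K+1)})=(z^{(K)}_{\hat N^{(K)}+1},u^{(K)}_{\hat N^{(K)}})$, choose $\rho^{(K+1)}$, and increase $K$ by one. The algorithm stops after the first cycle $K$ with $J^{(K)}\le\gamma^2$; otherwise it continues. It is understood that the search step succeeds and the subproblems are solvable in each cycle that is executed. *)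

(* Defs.v *)
From mathcomp Require Import all_boot all_order all_algebra.
From mathcomp Require Import all_classical all_reals all_analysis.

Set Implicit Arguments.
Unset Strict Implicit.
Unset Printing Implicit Defensive.

Import Order.TTheory GRing.Theory Num.Theory.
Import numFieldNormedType.Exports.

Local Open Scope classical_set_scope.
Local Open Scope ring_scope.

(* Vectors are ROW vectors, following the library's [jacobian]: for F : 'rV_n -> 'rV_m,
   v *m 'J F p is the differential of F at p applied to v, so 'J F p is the transpose of
   the textbook Jacobian and A z is written z *m A. *)

(* The library norm of a matrix is the sup norm, hence this Euclidean norm. *)
Definition enorm (R : realType) n (a : 'rV[R]_n) : R :=
  Num.sqrt (\sum_(i < n) a 0 i ^+ 2).

Definition qnorm (R : realType) n (Q : 'M[R]_n) (a : 'rV[R]_n) : R :=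
  Num.sqrt ((a *m Q *m a^T) 0 0).

Definition posdef (R : realType) n (Q : 'M[R]_n) : Prop :=
  Q^T = Q /\ forall a : 'rV[R]_n, a != 0 -> 0 < (a *m Q *m a^T) 0 0.

Definition position (R : realType) n (n_ge2 : (2 <= n)%N) (z : 'rV[R]_n) : 'rV[R]_2 :=
  \row_(i < 2) z 0 (widen_ord n_ge2 i).

Definition diam (R : realType) n (O : set 'rV[R]_n) : R :=
  sup [set enorm (xy.1 - xy.2) | xy in O `*` O].

Definition eball (R : realType) n (p : 'rV[R]_n) (rad : R) : set 'rV[R]_n :=
  [set x | enorm (x - p) <= rad].

Record problem (R : realType) (nz nu nobs : nat) := Problem {
  nz_ge2 : (2 <= nz)%N;
  fc : 'rV[R]_nz * 'rV[R]_nu -> 'rV[R]_nz;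
  stepsize : R;
  Q0 : 'M[R]_nz;
  Q1 : 'M[R]_nz;
  Q2 : 'M[R]_nu;
  obstacle : 'I_nobs -> set 'rV[R]_2;
  center : 'I_nobs -> 'rV[R]_2;
  sep : 'I_nobs -> R;
  z_init : 'rV[R]_nz;
  z_target : 'rV[R]_nz;
  tolerance : R;
  Nmax : nat
}.

(* Finite sequences are functions on nat, indexed from 1: only z_1, ..., z_{N+1} and
   u_1, ..., u_N are ever constrained or used for a sequence of horizon N. *)
Record traj (R : realType) (nz nu : nat) := Traj {
  zs : nat -> 'rV[R]_nz;
  us : nat -> 'rV[R]_nu
}.

(* The data of one planning cycle; cy_out is the output control accumulated up to and
   including this cycle. *)
Record plan_cycle (R : realType) (nz nu : nat) := PlanCycle {
  cy_z0 : 'rV[R]_nz;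
  cy_u0 : 'rV[R]_nu;
  cy_N : nat;
  cy_search : traj R nz nu;
  cy_relax : traj R nz nu;
  cy_k : nat -> R;
  cy_rho : R;
  cy_lf : nat -> R;
  cy_ld : nat -> R;
  cy_u : nat -> 'rV[R]_nu;
  cy_z : nat -> 'rV[R]_nz;
  cy_Nhat : nat;
  cy_out : seq 'rV[R]_nu
}.

Section Problem.
Variables (R : realType) (nz nu nobs : nat) (P : problem R nz nu nobs).

Notation Z := 'rV[R]_nz.
Notation U := 'rV[R]_nu.

Definition planar (z : Z) : 'rV[R]_2 := position (nz_ge2 P) z.

Definition obstacle_ball (j : 'I_nobs) : set 'rV[R]_2 :=
  eball (center P j) (diam (obstacle P j) / Num.sqrt 3).

Definition standing_assumptions : Prop :=
  [/\ (forall y, differentiable (fc P) y) /\ 0 < stepsize P,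
      posdef (Q1 P),
      posdef (Q2 P) &
      forall j : 'I_nobs,
        [/\ bounded_set (obstacle P j),
            obstacle P j `<=` obstacle_ball j &
            0 < sep P j]].

Definition f (y : Z * U) : Z := y.1 + stepsize P *: fc P y.

Definition linA (y0 : Z * U) : 'M[R]_nz := 'J (fun z => f (z, y0.2)) y0.1.
Definition linB (y0 : Z * U) : 'M[R]_(nu, nz) := 'J (fun u => f (y0.1, u)) y0.2.
Definition linw (y0 : Z * U) : Z := f y0 - y0.1 *m linA y0 - y0.2 *m linB y0.

Definition G1 (z : Z) : R := (z *m Q1 P *m z^T) 0 0 - 1.
Definition G2 (u : U) : R := (u *m Q2 P *m u^T) 0 0 - 1.

Definition J (N : nat) (z : nat -> Z) : R := qnorm (Q0 P) (z N.+1 - z_target P) ^+ 2.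

Definition avoids (z : Z) : Prop :=
  forall j : 'I_nobs, sep P j <= enorm (planar z - center P j).

Definition feasible_r (y0 : Z * U) (N : nat) (y : traj R nz nu) : Prop :=
  [/\ forall i, (1 <= i <= N)%N ->
        zs y i.+1 = zs y i *m linA y0 + us y i *m linB y0 + linw y0,
      zs y 1%N = y0.1,
      forall i, (1 <= i <= N.+1)%N -> G1 (zs y i) <= 0 &
      forall i, (1 <= i <= N)%N -> G2 (us y i) <= 0].

Definition feasible_1 (y0 : Z * U) (N : nat) (y : traj R nz nu) : Prop :=
  feasible_r y0 N y /\ forall i, (1 <= i <= N.+1)%N -> avoids (zs y i).

Definition optimal_r (y0 : Z * U) (N : nat) (y : traj R nz nu) : Prop :=
  feasible_r y0 N y /\
  forall y', feasible_r y0 N y' -> J N (zs y) <= J N (zs y').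

Section SubproblemS.
Variables (y0 : Z * U) (N : nat) (yt yb : traj R nz nu) (k : nat -> R) (rho : R).

Definition crossings (i : nat) (j : 'I_nobs) : set R :=
  [set l | 0 <= l <= 1 /\
     enorm (planar (l *: zs yt i + (1 - l) *: zs yb i) - center P j) = sep P j].

(* The largest element of [crossings i j], and 0 if there is none. *)
Definition lambda_ij (i : nat) (j : 'I_nobs) : R :=
  xget 0 [set l | crossings i j l /\ ubound (crossings i j) l].

Definition lambda_min (i : nat) : R := \big[Num.max/0]_(j < nobs) lambda_ij i j.

Definition mix (i : nat) (lf ld : R) : Z :=
  (1 - lambda_min i - lf + lambda_min i * lf) *: zs yb i
  + (lambda_min i + lf - lambda_min i * lf - ld) *: zs yt i
  + ld *: zs yt (maxn 1 i.-1).

(* The requirement on the pre-selected k_i: every state that P_s may choose at index i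
   satisfies the avoidance constraints, which are not repeated in P_s. *)
Definition admissible_k : Prop :=
  forall i, (1 <= i <= N.+1)%N ->
    0 <= k i <= 1 /\
    forall lf ld, 0 <= lf <= 1 -> 0 <= ld <= k i * lf -> avoids (mix i lf ld).

Definition mix_traj (lf ld : nat -> R) (u : nat -> U) : traj R nz nu :=
  Traj (fun i => mix i (lf i) (ld i)) u.

(* lambda_f - 1 as a vector of R^(N+1) *)
Definition lf_gap (n : nat) (lf : nat -> R) : 'rV[R]_n.+1 :=
  (\row_(i < n.+1) lf i.+1) - const_mx 1.

(* The inputs u are decision variables too, tied to lambda_f and lambda_d by the affine
   dynamics; the cost does not involve them. *)
Definition feasible_s (lf ld : nat -> R) (u : nat -> U) : Prop :=
  (forall i, (1 <= i <= N.+1)%N ->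
     [/\ 0 <= lf i <= 1, 0 <= ld i & ld i <= k i * lf i]) /\
  feasible_r y0 N (mix_traj lf ld u).

Definition cost_s (lf ld : nat -> R) (u : nat -> U) : R :=
  J N (zs (mix_traj lf ld u))
  + rho * enorm (y0.1 - z_target P) * enorm (lf_gap N lf) ^+ 2.

Definition optimal_s (lf ld : nat -> R) (u : nat -> U) : Prop :=
  feasible_s lf ld u /\
  forall lf' ld' u', feasible_s lf' ld' u' -> cost_s lf ld u <= cost_s lf' ld' u'.

End SubproblemS.

Definition cycle_cost (c : plan_cycle R nz nu) : R := J (cy_N c) (cy_z c).

Definition cycle_cost_tilde (c : plan_cycle R nz nu) : R :=
  qnorm (Q0 P) (cy_z c (cy_N c).+1 - z_target P) ^+ 2
  + cy_rho c * enorm (cy_z0 c - z_target P) * enorm (lf_gap (cy_N c) (cy_lf c)) ^+ 2.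

Definition applied (c : plan_cycle R nz nu) : seq U := [seq cy_u c i | i <- iota 1 (cy_Nhat c)].

Definition choice_Nhat (c : plan_cycle R nz nu) : Prop :=
  if tolerance P ^+ 2 < cycle_cost c
  then [/\ (1 <= cy_Nhat c)%N, (cy_Nhat c < cy_N c - 1)%N & (cy_Nhat c <= Nmax P)%N]
  else cy_Nhat c = cy_N c.

(* Steps (1)-(6) of a cycle started from (cy_z0 c, cy_u0 c). *)
Definition cycle_spec (c : plan_cycle R nz nu) : Prop :=
  let y0 := (cy_z0 c, cy_u0 c) in
  let N := cy_N c in
  [/\ feasible_1 y0 N (cy_search c),
      optimal_r y0 N (cy_relax c),
      admissible_k N (cy_search c) (cy_relax c) (cy_k c) /\ 0 <= cy_rho c,
      optimal_s y0 N (cy_search c) (cy_relax c) (cy_k c) (cy_rho c)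
        (cy_lf c) (cy_ld c) (cy_u c) &
      [/\ cy_z c 1%N = cy_z0 c,
          forall i, (2 <= i <= N.+1)%N -> cy_z c i = f (cy_z c i.-1, cy_u c i.-1) &
          choice_Nhat c]].

Definition first_cycle (c : plan_cycle R nz nu) : Prop :=
  [/\ cy_z0 c = z_init P, cy_u0 c = 0 & cy_out c = applied c].

Definition next_cycle (c c' : plan_cycle R nz nu) : Prop :=
  [/\ cy_z0 c' = cy_z c (cy_Nhat c).+1,
      cy_u0 c' = cy_u c (cy_Nhat c) &
      cy_out c' = cy_out c ++ applied c'].

(* A run lists the cycles from index 1 on. Cycle K is executed when no earlier cycle
   reached the tolerance; run K is meaningless for the other indices K. *)
Definition executed (run : nat -> plan_cycle R nz nu) (K : nat) : Prop :=
  (1 <= K)%N /\ forall k, (1 <= k < K)%N -> tolerance P ^+ 2 < cycle_cost (run k).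

Definition algorithm1 (run : nat -> plan_cycle R nz nu) : Prop :=
  [/\ first_cycle (run 1%N),
      forall K, executed run K -> cycle_spec (run K) &
      forall K, (1 <= K)%N -> executed run K.+1 -> next_cycle (run K) (run K.+1)].

Definition stops_at (run : nat -> plan_cycle R nz nu) (K : nat) : Prop :=
  executed run K /\ cycle_cost (run K) <= tolerance P ^+ 2.

End Problem.

(* Main.v *)
(* If no cycle met the tolerance, every cycle would be executed with cost above gamma^2,
   hence so would the regularized costs, whose penalty term is nonnegative. Being
   positive, they obey the contraction hypothesis in multiplicative form and so decay
   geometrically to 0, a contradiction. *)
Require Import Defs.
From mathcomp Require Import all_boot all_order all_algebra.
From mathcomp Require Import all_classical all_reals all_analysis.
Import Order.TTheory GRing.Theory Num.Theory.
Import numFieldNormedType.Exports.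
Local Open Scope classical_set_scope.
Local Open Scope ring_scope.

(** Iterating the contraction from [M] bounds [u (M + n)] by [u M * kappa ^+ n], which tends to 0
    since [kappa < 1]. *)
Lemma geometric_decay_lt (R : realType) (u : nat -> R) (kappa eps : R) (M : nat) :
  0 <= kappa < 1 -> 0 < eps ->
  (forall K, (M <= K)%N -> u K.+1 <= kappa * u K) ->
  exists K : nat, (M <= K)%N /\ u K < eps.
Proof.
move=> /andP[kappa0 kappa1] eps0 decay.
have bound n : u (M + n)%N <= u M * kappa ^+ n.
  elim: n => [|n IH]; first by rewrite addn0 expr0 mulr1.
  rewrite addnS exprS mulrCA.
  by apply: le_trans (decay _ (leq_addr _ _)) _; exact: ler_wpM2l.
have : geometric (u M) kappa @ \oo --> 0.
  by apply: cvg_geometric; rewrite ger0_norm.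
move=> /cvgr_lt/(_ _ eps0)[n _ small].
exists (M + n)%N; split; first exact: leq_addr.
exact: le_lt_trans (bound n) (small n (leqnn n)).
Qed.

Lemma cycle_cost_le_tilde (R : realType) (nz nu nobs : nat)
    (P : problem R nz nu nobs) (c : plan_cycle R nz nu) :
  0 <= cy_rho c -> cycle_cost P c <= cycle_cost_tilde P c.
Proof.
move=> rho0; rewrite /cycle_cost /J /cycle_cost_tilde lerDl.
by rewrite !mulr_ge0 ?sqr_ge0 ?sqrtr_ge0.
Qed.

(** The least [K >= 1] meeting the tolerance is the stopping cycle: by minimality all earlier costs
    exceed [tolerance P ^+ 2], which is what [executed] demands. *)
Lemma stops_or_runs_forever (R : realType) (nz nu nobs : nat)
    (P : problem R nz nu nobs) (run : nat -> plan_cycle R nz nu) :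
  (exists K, stops_at P run K) \/
  (forall K, (1 <= K)%N -> tolerance P ^+ 2 < cycle_cost P (run K)).
Proof.
pose small K := (1 <= K)%N && (cycle_cost P (run K) <= tolerance P ^+ 2).
have [smallE|nsmall] := pselect (exists K, small K); [left|right].
  case: (ex_minnP smallE) => K /andP[K_gt0 costK] minK.
  exists K; do 2![split=> //] => k /andP[k_gt0 ltkK].
  rewrite ltNge; apply/negP => costk.
  by have := minK k; rewrite /small k_gt0 costk leqNgt ltkK => /(_ isT).
move=> K K_gt0; rewrite ltNge; apply/negP => costK.
by apply: nsmall; exists K; rewrite /small K_gt0.
Qed.

Theorem theorem1 (R : realType) (nz nu nobs : nat) (P : problem R nz nu nobs)
    (run : nat -> plan_cycle R nz nu) :
  standing_assumptions P ->
  posdef (Q0 P) ->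
  0 < tolerance P ->
  algorithm1 P run ->
  (forall j : 'I_nobs,
     ~ obstacle_ball P j (planar P (z_init P)) /\
     ~ obstacle_ball P j (planar P (z_target P))) ->
  (exists kappa : R, 0 <= kappa < 1 /\
     \forall K \near \oo, executed P run K ->
       cycle_cost_tilde P (run K) / cycle_cost_tilde P (run K.-1) <= kappa) ->
  exists K : nat, stops_at P run K /\
    qnorm (Q0 P) (cy_z (run K) (cy_N (run K)).+1 - z_target P) <= tolerance P.
Proof.
move=> _ _ tol0 [_ spec _] _ [kappa [kappa01 [M _ ratio]]].
have [[K [execK costK]]|costs] := stops_or_runs_forever _ _ _ _ P run.
  exists K; split=> //.
  (* The cost is the squared [qnorm], and squaring is monotone on nonnegative reals. *)
  by rewrite -(@ler_pXn2r _ 2) ?nnegrE ?sqrtr_ge0 // ltW.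
have exec K : (1 <= K)%N -> executed P run K.
  by move=> K_gt0; split=> // k /andP[k_gt0 _]; exact: costs.
have tilde_gt K : (1 <= K)%N -> tolerance P ^+ 2 < cycle_cost_tilde P (run K).
  move=> K_gt0; have [_ _ [_ rho0] _ _] := spec K (exec K K_gt0).
  exact: lt_le_trans (costs K K_gt0) (cycle_cost_le_tilde _ _ _ _ _ _ rho0).
have tol2 : 0 < tolerance P ^+ 2 by rewrite exprn_gt0.
(* Starting at [M.+1] rather than [M] excludes index 0, where no cycle exists and positivity of the
   cost is unknown. *)
have [K leMK|K [leMK]] := geometric_decay_lt _
  (fun K => cycle_cost_tilde P (run K)) _ _ M.+1 kappa01 tol2.
  have K_gt0 : (1 <= K)%N by exact: leq_trans leMK.
  (* The positive denominator at [K] lets the ratio hypothesis, taken at [K.+1], be used as a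
     product bound. *)
  rewrite -ler_pdivrMr; last exact: lt_trans (tilde_gt K K_gt0).
  by apply: (ratio K.+1) (exec _ _) => //=; exact: leq_trans (ltnW leMK) _.
(* The index found is at least 1, so [tilde_gt] refutes a regularized cost below the squared
   tolerance. *)
by rewrite ltNge ltW // tilde_gt // (leq_trans _ leMK).
Qed.
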